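(* Let $n\ge2$. Let $A_1=\{12\text{-}3\}$, $A_2=\{2\text{-}13,21\text{-}3\}$, $A_3=\{2\text{-}31,23\text{-}1\}$, $A_4=\{32\text{-}1\}$. For every choice of $p_i\in A_i$ ($i=1,2,3,4$), $|S_n(p_1,p_2,p_3,p_4)|=2$ and $$S_n(p_1,p_2,p_3,p_4)=\{\,1\,n\,2\,(n-1)\ldots,\ \ n\,1\,(n-1)\,2\ldots\,\},$$ where the first permutation is obtained by alternately taking the smallest and the largest of the remaining elements of $\{1,\dots,n\}$, starting with the smallest, and the second by alternately taking the largest and the smallest of the remaining elements, starting with the largest.
   Context: $S_n$ is the set of permutations $\pi=\pi_1\pi_2\cdots\pi_n$ of $\{1,\dots,n\}$ (written in one-line notation). For $abc$ a permutation of $123$, the generalized pattern $a\text{-}bc$ is contained in $\pi$ if there are indices $i<j$ with $j+1\le n$ such that $\pi_i\pi_j\pi_{j+1}$ is order-isomorphic to $abc$; the generalized pattern $ab\text{-}c$ is contained in $\pi$ if there are indices $i,k$ with $i+1<k\le n$ such that $\pi_i\pi_{i+1}\pi_k$ is order-isomorphic to $abc$. $\pi$ avoids a pattern if it does not contain it. $S_n(p_1,\dots,p_m)$ is the set of $\pi\in S_n$ avoiding all of $p_1,\dots,p_m$. *)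

(* Defs.v *)
From HB Require Import structures.
From mathcomp Require Import all_boot all_fingroup.

Set Implicit Arguments.
Unset Strict Implicit.
Unset Printing Implicit Defensive.

(* [a_bc a b c] is the generalized pattern a-bc (the last two letters are
   adjacent), [ab_c a b c] is ab-c (the first two letters are adjacent). *)
Inductive gpattern :=
  | a_bc of nat & nat & nat
  | ab_c of nat & nat & nat.

Definition gpattern_code (p : gpattern) : bool * (nat * nat * nat) :=
  match p with
  | a_bc a b c => (true, (a, b, c))
  | ab_c a b c => (false, (a, b, c))
  end.

Definition gpattern_decode (t : bool * (nat * nat * nat)) : gpattern :=
  let: (d, (a, b, c)) := t in if d then a_bc a b c else ab_c a b c.

Lemma gpattern_codeK : cancel gpattern_code gpattern_decode.
Proof. by case. Qed.

HB.instance Definition _ := Equality.copy gpattern (can_type gpattern_codeK).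

Definition order_iso (u v : seq nat) : bool :=
  (size u == size v) &&
  [forall i : 'I_(size u), forall j : 'I_(size u),
     (nth 0 u i < nth 0 u j) == (nth 0 v i < nth 0 v j)].

(* Positions and letters of 'S_n are numbered from 0 in MathComp; [letter] and
   [one_line] restore the letters 1, ..., n. *)
Definition letter n (s : 'S_n) (i : 'I_n) : nat := (s i).+1.

Definition one_line n (s : 'S_n) : seq nat := [seq letter s i | i <- enum 'I_n].

Definition contains n (p : gpattern) (s : 'S_n) : bool :=
  match p with
  | a_bc a b c =>
      [exists i : 'I_n, exists j : 'I_n, exists k : 'I_n,
        [&& i < j, nat_of_ord k == j.+1
          & order_iso [:: letter s i; letter s j; letter s k] [:: a; b; c]]]
  | ab_c a b c =>
      [exists i : 'I_n, exists j : 'I_n, exists k : 'I_n,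
        [&& nat_of_ord j == i.+1, j < k
          & order_iso [:: letter s i; letter s j; letter s k] [:: a; b; c]]]
  end.

Definition avoids n (p : gpattern) (s : 'S_n) : bool := ~~ contains p s.

Definition Sn_avoiding n (ps : seq gpattern) : {set 'S_n} :=
  [set s : 'S_n | all (fun p => avoids p s) ps].

Definition smallest (r : seq nat) : nat := head 0 (sort leq r).
Definition largest (r : seq nat) : nat := last 0 (sort leq r).

Fixpoint alternate_rec (k : nat) (small : bool) (r : seq nat) : seq nat :=
  if k is k'.+1 then
    let x := if small then smallest r else largest r in
    x :: alternate_rec k' (~~ small) (rem x r)
  else [::].

(* List the elements of r by alternately taking the smallest and the largest
   remaining one, starting with the smallest iff [small]. *)
Definition alternate (small : bool) (r : seq nat) : seq nat :=
  alternate_rec (size r) small r.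

(* Main.v *)
Require Import Defs.
From mathcomp Require Import all_boot all_fingroup.
From mathcomp Require Import zify.

Set Implicit Arguments.
Unset Strict Implicit.

(** Call a word zigzag when each letter is alternately smaller and larger than
    all the letters following it.  Up to its first direction, a zigzag word is
    determined by its set of letters, which gives the two words of the theorem.
    A zigzag word has no occurrence of a classical pattern starting with 2, and
    avoids 12-3 and 32-1 by alternation.  Conversely, avoiding 2-13 implies
    avoiding 213, hence 21-3, since a walk from below a value to above it jumps
    over it at some step, and likewise for 2-31 and 23-1; and avoiding 12-3,
    21-3, 23-1 and 32-1 says that any two adjacent letters strictly enclose all
    the later ones, whence the word is zigzag. *)

(** * Zigzag words and alternating arrangements *)

Definition beyond (b : bool) (x y : nat) : bool := if b then x < y else y < x.

Lemma beyond_asym b x y : beyond b x y -> ~~ beyond b y x.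
Proof. by case: b; rewrite /beyond -leqNgt => /ltnW. Qed.

Fixpoint zigzag (b : bool) (w : seq nat) : bool :=
  if w is x :: t then all (beyond b x) t && zigzag (~~ b) t else true.

(** Sorting forgets the order of the letters, and removing the same letter from both lists leaves
    them permutations of each other. This later allows a one-line word to be replaced by
    [iota 1 n]. *)
Lemma perm_alternate_rec k b (r r' : seq nat) :
  perm_eq r r' -> alternate_rec k b r = alternate_rec k b r'.
Proof.
elim: k b r r' => //= k IHk b r r' rr'.
have /perm_sortP rr's := rr'; rewrite /smallest /largest.
rewrite (rr's _ leq_total leq_trans anti_leq); congr (_ :: _).
apply/IHk/seq.permP => a; rewrite !count_rem (seq.permP rr').
by rewrite (perm_mem rr').
Qed.

Lemma perm_alternate b (r r' : seq nat) :
  perm_eq r r' -> alternate b r = alternate b r'.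
Proof.
by move=> rr'; rewrite /alternate (perm_size rr'); apply: perm_alternate_rec.
Qed.

Lemma smallest_mem (r : seq nat) : r != [::] -> smallest r \in r.
Proof.
move=> r0; rewrite -(mem_sort leq) /smallest -nth0 mem_nth //.
by rewrite size_sort lt0n size_eq0.
Qed.

Lemma largest_mem (r : seq nat) : r != [::] -> largest r \in r.
Proof.
move=> r0; rewrite -(mem_sort leq) /largest -nth_last mem_nth //.
by rewrite size_sort prednK // lt0n size_eq0.
Qed.

Lemma smallest_le (r : seq nat) y : y \in r -> smallest r <= y.
Proof.
rewrite -(mem_sort leq) /smallest.
have := sort_sorted leq_total r; case: (sort _ _) => //= x t.
rewrite (path_sortedE leq_trans) => /andP[/allP xt _].
by rewrite inE => /predU1P[-> //|/xt].
Qed.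

Lemma largest_ge (r : seq nat) y : y \in r -> y <= largest r.
Proof.
rewrite -(mem_sort leq) /largest.
move=> yr; have := sort_sorted leq_total r.
move=> /(sorted_leq_nth leq_trans leqnn 0) le_nth.
have := yr; rewrite -index_mem => yi; rewrite -[leqLHS](nth_index 0 yr) -nth_last.
by apply: le_nth; rewrite ?inE; move: (index _ _) (size _) yi => i m; lia.
Qed.

Definition extremum (b : bool) (r : seq nat) : nat :=
  if b then smallest r else largest r.

Lemma extremum_mem b (r : seq nat) : r != [::] -> extremum b r \in r.
Proof. by case: b; [apply: smallest_mem | apply: largest_mem]. Qed.

Lemma beyond_extremum b (r : seq nat) y :
  y \in r -> y != extremum b r -> beyond b (extremum b r) y.
Proof.
move=> yr; rewrite /beyond; case: b => /=; rewrite ltn_neqAle.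
  by rewrite smallest_le // eq_sym => ->.
by rewrite largest_ge // => ->.
Qed.

Lemma alternate_cons b (r : seq nat) : r != [::] ->
  alternate b r = extremum b r :: alternate (~~ b) (rem (extremum b r) r).
Proof.
move=> r0; rewrite /alternate size_rem ?extremum_mem //.
by rewrite -[in LHS](@prednK (size r)) // lt0n size_eq0.
Qed.

Lemma alternate_perm b (r : seq nat) : perm_eq (alternate b r) r.
Proof.
move sr: (size r) => m; elim: m b r sr => [|m IHm] b r sr.
  by rewrite (size0nil sr).
have r0 : r != [::] by rewrite -size_eq0 sr.
rewrite alternate_cons // perm_sym.
rewrite (perm_trans (perm_to_rem (extremum_mem b r0))) // perm_cons perm_sym.
by apply: IHm; rewrite size_rem ?extremum_mem // sr.
Qed.

(** The extremum taken at each step is removed from a list of distinct letters, so every letter left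
    differs from it and lies strictly on the required side. *)
Lemma zigzag_alternate b (r : seq nat) : uniq r -> zigzag b (alternate b r).
Proof.
move sr: (size r) => m; elim: m b r sr => [|m IHm] b r sr ur.
  by rewrite (size0nil sr).
have r0 : r != [::] by rewrite -size_eq0 sr.
rewrite alternate_cons //= IHm ?rem_uniq ?size_rem ?extremum_mem ?sr // andbT.
rewrite (perm_all _ (alternate_perm _ _)); apply/allP => y.
by rewrite mem_rem_uniq // !inE => /andP[yx yr]; apply: beyond_extremum.
Qed.

(** The first letter must be the extremum in direction [b]: an extremum found in the tail would be
    both before and after [x] in the strict order. With [perm_alternate], this makes a zigzag word
    depend only on [b] and its letters. *)
Lemma alternate_zigzag b (w : seq nat) : zigzag b w -> alternate b w = w.
Proof.
elim: w b => //= x t IHt b /andP[/allP xt zt].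
suff x_ext : extremum b (x :: t) = x.
  by rewrite alternate_cons // x_ext /= eqxx IHt.
apply/eqP; have := @extremum_mem b (x :: t) isT.
rewrite inE => /predU1P[->//|/xt x_lt]; apply/negPn/negP; rewrite eq_sym => x_ne.
by have := beyond_asym x_lt; rewrite beyond_extremum ?mem_head.
Qed.

Lemma zigzag_nth b (w : seq nat) i k : zigzag b w -> i < k < size w ->
  beyond (b (+) odd i) (nth 0 w i) (nth 0 w k).
Proof.
elim: w b i k => [|x t IHt] b i [|k] /=; rewrite ?ltn0 ?andbF //.
move=> /andP[/allP xt zt]; case: i => [|i] ik; first by rewrite addbF xt ?mem_nth.
by rewrite addbN -addNb; apply: IHt.
Qed.

(** Letters enclosed by [x] and [y] lie on the same side of [x] as [y] does, and on the opposite
    side of [y], so the direction flips at each position. *)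
Lemma nested_zigzag (w : seq nat) : uniq w ->
  (forall i k, i.+1 < k < size w ->
     minn (nth 0 w i) (nth 0 w i.+1) < nth 0 w k
       < maxn (nth 0 w i) (nth 0 w i.+1)) ->
  zigzag (nth 0 w 0 < nth 0 w 1) w.
Proof.
elim: w => [|x [|y t] IHt] //= /andP[]; rewrite inE => /norP[xy _] uyt nest.
have nest0 z : z \in t -> minn x y < z < maxn x y.
  by move=> /(nthP 0)[k kt <-]; apply: (nest 0 k.+2).
have {}IHt : zigzag (y < nth 0 t 0) (y :: t).
  by apply: IHt => // i k ik; apply: (nest i.+1 k.+1).
have -> : beyond (x < y) x y by rewrite /beyond; case: ifP; lia.
have -> : all (beyond (x < y) x) t.
  by apply/allP => z /nest0; rewrite /beyond; case: ifP; lia.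
(* For empty [t], the induction hypothesis compares [y] with the default letter 0, which is
   harmless: a one-letter word is zigzag in both directions. *)
case: t nest0 IHt {nest uyt} => //= z t nest0.
suff -> : y < z = ~~ (x < y) by [].
by have := nest0 z (mem_head _ _); lia.
Qed.

(** * Pattern occurrences and one-line words *)

Lemma order_iso3 x y z a b c :
  order_iso [:: x; y; z] [:: a; b; c] =
  [&& (x < y) == (a < b), (y < x) == (b < a), (x < z) == (a < c),
      (z < x) == (c < a), (y < z) == (b < c) & (z < y) == (c < b)].
Proof.
rewrite /order_iso /=; apply/'forall_forallP/idP => [iso | iso [i lti] [j ltj]].
  pose o i (lti : i < 3) := Ordinal lti.
  have := iso (o 0 isT) (o 1 isT); have := iso (o 1 isT) (o 0 isT).
  have := iso (o 0 isT) (o 2 isT); have := iso (o 2 isT) (o 0 isT).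
  have := iso (o 1 isT) (o 2 isT); have := iso (o 2 isT) (o 1 isT).
  by rewrite /= => -> -> -> -> -> ->.
case/and5P: iso => ? ? ? ? /andP[? ?].
by case: i j lti ltj => [|[|[|//]]] [|[|[|//]]] _ _ //=; rewrite !ltnn.
Qed.

Section OneLine.
Context {n : nat}.
Implicit Types s : 'S_n.

Lemma size_one_line s : size (one_line s) = n.
Proof. by rewrite size_map size_enum_ord. Qed.

Lemma nth_one_line s (i : 'I_n) : nth 0 (one_line s) i = letter s i.
Proof. by rewrite (nth_map i) ?size_enum_ord // nth_ord_enum. Qed.

Lemma one_line_uniq s : uniq (one_line s).
Proof. by rewrite map_inj_uniq ?enum_uniq // => i j [] /val_inj/perm_inj. Qed.

Lemma one_line_inj : injective (@one_line n).
Proof.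
move=> s s' eq_ss'; apply/permP => i; apply/val_inj/succn_inj.
by rewrite -[LHS]nth_one_line eq_ss' nth_one_line.
Qed.

Lemma one_line_perm s : perm_eq (one_line s) (iota 1 n).
Proof.
apply: uniq_perm; rewrite ?one_line_uniq ?iota_uniq //.
have sub_iota : {subset one_line s <= iota 1 n}.
  by move=> _ /mapP[i _ ->]; rewrite mem_iota /letter; have := ltn_ord (s i); lia.
have [|//] := uniq_min_size (one_line_uniq s) sub_iota.
by rewrite size_iota size_one_line.
Qed.

Lemma perm_one_line w : perm_eq w (iota 1 n) -> exists s, one_line s = w.
Proof.
move=> w_perm; have sw : size w = n by rewrite (perm_size w_perm) size_iota.
have uw : uniq w by rewrite (perm_uniq w_perm) iota_uniq.
have w_range (i : 'I_n) : 0 < nth 0 w i <= n.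
  have : nth 0 w i \in iota 1 n by rewrite -(perm_mem w_perm) mem_nth ?sw.
  by rewrite mem_iota add1n ltnS.
(* Letters start at 1 and ordinals at 0, so the permutation sends each position to the predecessor
   of its letter. *)
have w_lt (i : 'I_n) : (nth 0 w i).-1 < n by have := w_range i; lia.
have f_inj : injective (fun i => Ordinal (w_lt i)).
  move=> i j [eq_ij]; apply/val_inj/eqP.
  rewrite -(nth_uniq 0 _ _ uw) ?sw //=.
  by have := w_range i; have := w_range j; lia.
exists (perm f_inj); apply: (@eq_from_nth _ 0); rewrite size_one_line ?sw // => i lti.
rewrite -[i]/(val (Ordinal lti)) nth_one_line /letter permE /= prednK //.
by have /andP[] := w_range (Ordinal lti).
Qed.

Lemma contains_a_bcP a b c s (w := one_line s) :
  reflect (exists i j, [/\ i < j, j.+1 < n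
             & order_iso [:: nth 0 w i; nth 0 w j; nth 0 w j.+1] [:: a; b; c]])
          (contains (a_bc a b c) s).
Proof.
apply: (iffP idP) => [/existsP[i /existsP[j /existsP[k]]] | [i [j [ij jn iso]]]].
  case/and3P=> ij /eqP kj; rewrite -!nth_one_line kj => iso.
  by exists i, j; split=> //; rewrite -kj.
have jn' := ltnW jn; have in' := ltn_trans ij jn'.
apply/existsP; exists (Ordinal in'); apply/existsP; exists (Ordinal jn').
by apply/existsP; exists (Ordinal jn); rewrite -!nth_one_line /= ij eqxx.
Qed.

Lemma contains_ab_cP a b c s (w := one_line s) :
  reflect (exists i k, [/\ i.+1 < k, k < n
             & order_iso [:: nth 0 w i; nth 0 w i.+1; nth 0 w k] [:: a; b; c]])
          (contains (ab_c a b c) s).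
Proof.
apply: (iffP idP) => [/existsP[i /existsP[j /existsP[k]]] | [i [k [ik kn iso]]]].
  case/and3P=> /eqP ji jk; rewrite -!nth_one_line ji => iso.
  by exists i, k; split=> //; rewrite -ji.
have in1 := ltn_trans ik kn; have in' := ltnW in1.
apply/existsP; exists (Ordinal in'); apply/existsP; exists (Ordinal in1).
by apply/existsP; exists (Ordinal kn); rewrite -!nth_one_line /= ik eqxx.
Qed.

End OneLine.

(** * Zigzag permutations and pattern avoidance *)

Lemma last_true_step (P : pred nat) j k : j <= k -> P j -> ~~ P k ->
  exists m, [/\ j <= m, m < k, P m & ~~ P m.+1].
Proof.
elim: k => [|k IHk]; first by case: j => // _ ->.
rewrite leq_eqVlt => /predU1P[-> -> //|]; rewrite ltnS => jk Pj Pk.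
have [Pk'|nPk] := boolP (P k); first by exists k.
by have [m [jm mk ? ?]] := IHk jk Pj nPk; exists m; split=> //; apply: ltnW.
Qed.

(** The word is below its letter at [i] at position [i.+1] and above it at [k]; the step where it
    crosses this level supplies the adjacent letters 13. *)
Lemma contains_21_3_2_13 n (s : 'S_n) : contains (ab_c 2 1 3) s -> contains (a_bc 2 1 3) s.
Proof.
case/contains_ab_cP=> i [k [ik kn]]; rewrite order_iso3 => iso.
set w := one_line s in iso.
have [||m [im mk wm wm1]] := @last_true_step (fun m => nth 0 w m < nth 0 w i) _ _ (ltnW ik).
- by lia.
- by lia.
(* The crossing step only gives a weak inequality; distinctness of the letters makes it strict. *)
have wne : nth 0 w i != nth 0 w m.+1.
  by rewrite nth_uniq ?size_one_line ?one_line_uniq //; lia.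
apply/contains_a_bcP; exists i, m; rewrite order_iso3 -/w; split; lia.
Qed.

Lemma contains_23_1_2_31 n (s : 'S_n) : contains (ab_c 2 3 1) s -> contains (a_bc 2 3 1) s.
Proof.
case/contains_ab_cP=> i [k [ik kn]]; rewrite order_iso3 => iso.
set w := one_line s in iso.
have [||m [im mk wm wm1]] := @last_true_step (fun m => nth 0 w i < nth 0 w m) _ _ (ltnW ik).
- by lia.
- by lia.
have wne : nth 0 w i != nth 0 w m.+1.
  by rewrite nth_uniq ?size_one_line ?one_line_uniq //; lia.
apply/contains_a_bcP; exists i, m; rewrite order_iso3 -/w; split; lia.
Qed.

(** A letter with all later ones on one side cannot play the 2 of a pattern starting with 2. In 12-3
    or 32-1, the first two letters fix the direction at [i], and the opposite direction at [i.+1]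
    contradicts the third letter. *)
Lemma zigzag_avoids n (s : 'S_n) b p : zigzag b (one_line s) ->
  p \in [:: ab_c 1 2 3; a_bc 2 1 3; ab_c 2 1 3; a_bc 2 3 1; ab_c 2 3 1; ab_c 3 2 1] ->
  avoids p s.
Proof.
move=> zs; set w := one_line s in zs.
have zw i k : i < k < n -> beyond (b (+) odd i) (nth 0 w i) (nth 0 w k).
  by move=> ik; apply: zigzag_nth; rewrite ?size_one_line.
have zw_ab i k : i.+1 < k -> k < n ->
    [/\ beyond (b (+) odd i) (nth 0 w i) (nth 0 w i.+1),
        beyond (b (+) odd i) (nth 0 w i) (nth 0 w k)
      & beyond (~~ (b (+) odd i)) (nth 0 w i.+1) (nth 0 w k)].
  move=> ik kn; split; [apply: zw; lia | apply: zw; lia |].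
  by rewrite -addbN; apply: (zw i.+1); rewrite ik.
have zw_bc i j : i < j -> j.+1 < n ->
    beyond (b (+) odd i) (nth 0 w i) (nth 0 w j) /\
    beyond (b (+) odd i) (nth 0 w i) (nth 0 w j.+1).
  by move=> ij jn; split; apply: zw; lia.
rewrite /avoids !inE => p_in; apply/negP; move: p_in.
case/or4P=> [||| /or3P[]] /eqP->; rewrite /beyond in zw_ab zw_bc;
  (case/contains_ab_cP || case/contains_a_bcP) => i [k [ik kn]];
  rewrite order_iso3 -/w;
  (case: (zw_ab i k ik kn) || case: (zw_bc i k ik kn));
  by case: (b (+) odd i) => /=; lia.
Qed.

(** A later letter not enclosed by two adjacent ones is above both, giving 12-3 or 21-3, or below
    both, giving 23-1 or 32-1. *)
Lemma avoids_zigzag n (s : 'S_n) (w := one_line s) :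
  avoids (ab_c 1 2 3) s -> avoids (ab_c 2 1 3) s ->
  avoids (ab_c 2 3 1) s -> avoids (ab_c 3 2 1) s ->
  zigzag (nth 0 w 0 < nth 0 w 1) w.
Proof.
rewrite /avoids => av123 av213 av231 av321.
apply: nested_zigzag => [|i k]; first exact: one_line_uniq.
rewrite size_one_line => /andP[ik kn].
have uw := one_line_uniq s; have sw := size_one_line s; rewrite -/w in uw sw.
have ne1 : nth 0 w i != nth 0 w i.+1 by rewrite nth_uniq ?sw //; lia.
have ne2 : nth 0 w i != nth 0 w k by rewrite nth_uniq ?sw //; lia.
have ne3 : nth 0 w i.+1 != nth 0 w k by rewrite nth_uniq ?sw //; lia.
have not_iso a b c : ~~ contains (ab_c a b c) s ->
    ~~ order_iso [:: nth 0 w i; nth 0 w i.+1; nth 0 w k] [:: a; b; c].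
  by apply: contraNN => iso; apply/contains_ab_cP; exists i, k.
move: (not_iso _ _ _ av123) (not_iso _ _ _ av213).
move: (not_iso _ _ _ av231) (not_iso _ _ _ av321).
by rewrite !order_iso3; lia.
Qed.

(** * Identification and count of the avoiding permutations *)

Unset Implicit Arguments.

Theorem proposition2p8 (n : nat) (n_ge2 : 2 <= n) (p1 p2 p3 p4 : gpattern)
    (p1_A1 : p1 \in [:: ab_c 1 2 3])
    (p2_A2 : p2 \in [:: a_bc 2 1 3; ab_c 2 1 3])
    (p3_A3 : p3 \in [:: a_bc 2 3 1; ab_c 2 3 1])
    (p4_A4 : p4 \in [:: ab_c 3 2 1]) :
  #|Sn_avoiding n [:: p1; p2; p3; p4]| = 2 /\
  [seq one_line s | s in Sn_avoiding n [:: p1; p2; p3; p4]]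
    =i [:: alternate true (iota 1 n); alternate false (iota 1 n)].
Proof.
set S := Sn_avoiding _ _; set L := [:: _; _].
have avoiding_zigzag s : s \in S -> exists b, zigzag b (one_line s).
  rewrite inE /= andbT => /and4P[av1 av2 av3 av4].
  exists (nth 0 (one_line s) 0 < nth 0 (one_line s) 1); apply: avoids_zigzag.
  - by move: p1_A1 av1; rewrite inE => /eqP->.
  - move: p2_A2 av2; rewrite !inE => /orP[] /eqP-> //.
    exact/contraNN/contains_21_3_2_13.
  - move: p3_A3 av3; rewrite !inE => /orP[] /eqP-> //.
    exact/contraNN/contains_23_1_2_31.
  - by move: p4_A4 av4; rewrite inE => /eqP->.
have zigzag_avoiding s b : zigzag b (one_line s) -> s \in S.
  move=> zs; rewrite inE; apply/allP => p p_in; apply: zigzag_avoids zs _.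
  move: p1_A1 p2_A2 p3_A3 p4_A4 p_in; rewrite !inE.
  move=> /eqP-> p2E p3E /eqP->.
  by case/or4P=> /eqP-> //; [case/orP: p2E | case/orP: p3E] => /eqP->.
have inL w : (w \in L) = (w == alternate true (iota 1 n)) || (w == alternate false (iota 1 n)).
  by rewrite !inE.
have image_L : [seq one_line s | s in S] =i L.
  move=> w; apply/imageP/idP => [[s /avoiding_zigzag[b zs] ->] | w_in].
    (* Being zigzag, the word is the alternating arrangement of its own letters, which are 1 to
       [n]. *)
    rewrite -(alternate_zigzag zs) (perm_alternate b (one_line_perm s)) inL.
    by case: b {zs}; rewrite eqxx ?orbT.
  have [b ->] : exists b, w = alternate b (iota 1 n).
    by move: w_in; rewrite inL => /orP[] /eqP->; [exists true | exists false].
  have [s sw] := perm_one_line (alternate_perm b (iota 1 n)).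
  exists s => //; apply: (@zigzag_avoiding s b); rewrite sw.
  by apply: zigzag_alternate; apply: iota_uniq.
(* The two words differ because their first two letters, which exist as [n] is at least 2, are in
   opposite orders. *)
split=> //; have L_uniq : uniq L.
  rewrite /= inE andbT; apply/negP => /eqP eqL.
  have z b := zigzag_alternate b (iota_uniq 1 n).
  have sz b : size (alternate b (iota 1 n)) = n.
    by rewrite (perm_size (alternate_perm _ _)) size_iota.
  have := @zigzag_nth _ _ 0 1 (z true); have := @zigzag_nth _ _ 0 1 (z false).
  by rewrite eqL sz n_ge2 /= => /(_ isT) /[swap] /(_ isT); lia.
(* Injectivity of [one_line] turns the equality of sets of words into a count of permutations. *)
have im_uniq : uniq [seq one_line s | s in S].
  by rewrite map_inj_uniq ?enum_uniq //; apply: one_line_inj.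
by rewrite -(size_image (@one_line n)) (perm_size (uniq_perm im_uniq L_uniq image_L)).
Qed.
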